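(* Let $n,r\ge1$, let $\rho,\sigma\in\mathbb{C}^{n\times n}$ be density matrices, and let $$f(\mathbf{p},U_1,\dots,U_r)=\tfrac12\Big\|\sigma-\sum_{k=1}^r p_kU_k\rho U_k^*\Big\|_F^2 .$$ Let $\gamma(t)=(\mathbf{p}(t),U_1(t),\dots,U_r(t))$, $t\ge 0$ in its interval of existence, be a solution of the system $$\frac{dU_k}{dt}=-U_k\,\mathrm{skew}\Big(U_k^*\frac{\partial f}{\partial U_k}\Big),\qquad \frac{dp_k}{dt}=-\frac{\partial f}{\partial p_k}+\frac1r\sum_{\ell=1}^r\frac{\partial f}{\partial p_\ell},\qquad k=1,\dots,r,$$ with $U_1(0),\dots,U_r(0)$ unitary and $\mathbf{p}(0)=(p_1(0),\dots,p_r(0))$ satisfying $p_k(0)>0$ for all $k$ and $\sum_{k=1}^r p_k(0)=1$. Then the objective value $f(\gamma(t))$ does not increase over time along the trajectory $\gamma(t)$.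
   Context: A density matrix is a positive semidefinite Hermitian matrix of trace one. $\mathbf{p}\in\mathbb{R}^r$, $U_k\in\mathbb{C}^{n\times n}$, $X^*$ is the conjugate transpose, $\|\cdot\|_F$ is the Frobenius norm, and $\mathrm{skew}(A)=\frac12(A-A^* )$. Writing $U_k=U_k^{\mathfrak R}+iU_k^{\mathfrak I}$ with real matrices $U_k^{\mathfrak R},U_k^{\mathfrak I}$ (entrywise real and imaginary parts), the symbol $\frac{\partial f}{\partial U_k}$ in the system denotes the Euclidean gradient $\frac{\partial f}{\partial U_k^{\mathfrak R}}+i\frac{\partial f}{\partial U_k^{\mathfrak I}}$, where the derivative with respect to a real matrix is the matrix of entrywise partial derivatives. *)

(* Defs.v *)
From HB Require Import structures.
From mathcomp Require Import all_boot all_order all_algebra.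
From mathcomp Require Import complex.
From mathcomp Require Import all_classical all_reals all_analysis.

Set Implicit Arguments.
Unset Strict Implicit.
Unset Printing Implicit Defensive.

Import Order.TTheory GRing.Theory Num.Theory Num.Def.
Import numFieldNormedType.Exports.

Local Open Scope classical_set_scope.
Local Open Scope ring_scope.
Local Open Scope complex_scope.
Local Open Scope sesquilinear_scope.

Section ComplexMatrices.
Context {R : realType} {n : nat}.
Implicit Types (A U : 'M[R[i]]_n) (X Y : 'M[R]_n).

Definition reM A : 'M[R]_n := map_mx (@complex.Re R) A.
Definition imM A : 'M[R]_n := map_mx (@complex.Im R) A.
Definition complexM X Y : 'M[R[i]]_n := \matrix_(i, j) (X i j +i* Y i j).

(* In R[i], [0 <= z] means that z is real and nonnegative. *)
Definition psd_mx A :=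
  forall x : 'cV[R[i]]_n, 0 <= (x ^t* *m A *m x) 0 0.

Definition density_mx A := [/\ A \is hermsymmx, psd_mx A & \tr A = 1].

Definition skewM A : 'M[R[i]]_n := 2^-1 *: (A - A ^t*).

Definition frobenius_norm A : R :=
  Num.sqrt (\sum_i \sum_j ComplexField.Normc.normc (A i j) ^+ 2).

(* Partial derivatives are directional derivatives along the matrix units,
   taken separately in the real and in the imaginary part of the argument. *)
Definition euclidean_gradient (F : 'M[R[i]]_n -> R) U : 'M[R[i]]_n :=
  complexM
    (\matrix_(i, j)
       'D_(delta_mx i j) (fun X : 'M[R]_n => F (complexM X (imM U))) (reM U))
    (\matrix_(i, j)
       'D_(delta_mx i j) (fun Y : 'M[R]_n => F (complexM (reM U) Y)) (imM U)).

End ComplexMatrices.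

Section GradientFlow.
Context {R : realType} {n r : nat}.
Variables (rho sigma : 'M[R[i]]_n).
Implicit Types (p : 'rV[R]_r) (U : 'I_r -> 'M[R[i]]_n).

Definition objective p U : R :=
  2^-1 * frobenius_norm
           (sigma - \sum_(k < r) (p 0 k)%:C *: (U k *m rho *m (U k) ^t*)) ^+ 2.

Definition dobjective_dp p U (k : 'I_r) : R :=
  'D_(delta_mx 0 k) (fun q : 'rV[R]_r => objective q U) p.

Definition dobjective_dU p U (k : 'I_r) : 'M[R[i]]_n :=
  euclidean_gradient (fun V => objective p [eta U with k |-> V]) (U k).

(* The derivative of g at t relative to J: two-sided at interior points of J,
   one-sided at an endpoint of J belonging to J. *)
Definition has_derivative_within {V : normedModType R} (J : set R)
    (g : R -> V) (t : R) (l : V) :=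
  (s - t)^-1 *: (g s - g t) @[s --> within J t^'] --> l.

Definition flow_solution (J : set R)
    (p : R -> 'rV[R]_r) (U : R -> 'I_r -> 'M[R[i]]_n) :=
  forall t, J t -> forall k : 'I_r,
    let dU := - (U t k *m
                 skewM ((U t k) ^t* *m dobjective_dU (p t) (U t) k)) in
    [/\ has_derivative_within J (fun s => reM (U s k)) t (reM dU),
        has_derivative_within J (fun s => imM (U s k)) t (imM dU) &
        has_derivative_within J (fun s => p s 0 k : R^o) t
          (- dobjective_dp (p t) (U t) k
           + r%:R^-1 * \sum_(l < r) dobjective_dp (p t) (U t) l)].

End GradientFlow.

(* Main.v *)
Require Import Defs.
From mathcomp Require Import all_boot all_order all_algebra.
From mathcomp Require Import complex ring.
From mathcomp Require Import all_classical all_reals all_analysis.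
Import Order.TTheory GRing.Theory Num.Theory Num.Def.
Import numFieldNormedType.Exports.
Local Open Scope classical_set_scope.
Local Open Scope ring_scope.
Local Open Scope complex_scope.
Local Open Scope sesquilinear_scope.

(* With the real inner product <A, B> = Re tr(A^* B), the chain rule gives along
   a trajectory, for g_k = df/dp_k and G_k = df/dU_k,
     df/dt = sum_k (dp_k/dt) g_k + sum_k <G_k, dU_k/dt>.
   The first sum is - sum_k (g_k - m)^2, where m is the mean of the g_k.  For
   the second, <G_k, - U_k skew(U_k^* G_k)> = - <U_k^* G_k, skew(U_k^* G_k)>
   = - |skew(U_k^* G_k)|^2.  So df/dt <= 0.  The chain rule for the polynomial
   f comes from the product rule along an arbitrary curve, applied both to the
   trajectory and to the coordinate lines that define the partial derivatives. *)

(** * Differentiation rules for scalar functions relative to a set *)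

Section DerivativeWithin.
Context {R : realType}.
Variables (J : set R) (t : R).
Implicit Types (f g : R -> R^o) (l m : R).

Local Notation deriv f l := (@has_derivative_within R R^o J f t l).

Lemma deriv_within_cst (c : R) : deriv (fun=> c) 0.
Proof.
rewrite /has_derivative_within.
under eq_fun do rewrite subrr scaler0; exact: cvg_cst.
Qed.

Lemma deriv_withinD f g l m :
  deriv f l -> deriv g m -> deriv (fun s => f s + g s) (l + m).
Proof.
move=> df dg; rewrite /has_derivative_within.
under eq_fun do rewrite opprD addrACA scalerDr; exact: cvgD.
Qed.

Lemma deriv_withinZ (c : R) f l : deriv f l -> deriv (fun s => c * f s) (c * l).
Proof.
move=> df; rewrite /has_derivative_within.
under eq_fun do rewrite -mulrBr [_ *: _]mulrCA.
exact: cvgMr.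
Qed.

Lemma deriv_withinN f l : deriv f l -> deriv (fun s => - f s) (- l).
Proof.
by move=> /(@deriv_withinZ (-1)); under eq_fun do rewrite mulN1r; rewrite mulN1r.
Qed.

Lemma deriv_withinB f g l m :
  deriv f l -> deriv g m -> deriv (fun s => f s - g s) (l - m).
Proof. by move=> df dg; apply/deriv_withinD/deriv_withinN. Qed.

Lemma deriv_within_sum (I : finType) (f : I -> R -> R) (l : I -> R) :
  (forall i, deriv (f i) (l i)) -> deriv (fun s => \sum_i f i s) (\sum_i l i).
Proof.
move=> df.
suff: forall r, deriv (fun s => \sum_(i <- r) f i s) (\sum_(i <- r) l i) by apply.
elim=> [|i r IHr].
  by rewrite big_nil; under eq_fun do rewrite big_nil; exact: deriv_within_cst.
by rewrite big_cons; under eq_fun do rewrite big_cons; exact: deriv_withinD.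
Qed.

(** Away from [t], [f s] is [s - t] times the difference quotient, plus [f t]; the first factor
    tends to 0 and the quotient to [l]. *)
Lemma deriv_within_continuous f l :
  deriv f l -> f s @[s --> within J t^'] --> f t.
Proof.
move=> df.
have dt : (s - t) @[s --> within J t^'] --> (0 : R^o).
  rewrite -(subrr t); apply: cvgB; last exact: cvg_cst.
  apply: cvg_trans (@nbhs_dnbhs _ t); exact: cvg_within.
have : (s - t) * ((s - t)^-1 *: (f s - f t)) + f t @[s --> within J t^'] --> f t.
  rewrite -[X in _ --> X]add0r -(mul0r l).
  by apply: cvgD; [exact: cvgM | exact: cvg_cst].
apply: cvg_trans; apply: near_eq_cvg.
(* The cancellation of [s - t] is legitimate because the filter is punctured at [t]. *)
have tJ : (within J t^') [set s | s != t].
  exact: cvg_within (nbhs_dnbhs_neq t).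
apply: filterS tJ => s /= st.
by rewrite -[(s - t) * _]/(_ *: _) scalerA divff ?subr_eq0// scale1r subrK.
Qed.

Lemma deriv_withinM f g l m :
  deriv f l -> deriv g m -> deriv (fun s => f s * g s : R) (l * g t + f t * m).
Proof.
move=> df dg; rewrite /has_derivative_within.
(* Inserting [f t * g s] splits the quotient; the factor [g s] that remains is why continuity of [g]
   relative to [J] enters. *)
have -> : (fun s => (s - t)^-1 *: (f s * g s - f t * g t : R^o)) =
    (fun s => ((s - t)^-1 *: (f s - f t)) * g s
              + f t * ((s - t)^-1 *: (g s - g t)) : R^o).
  apply/funext => s; rewrite /GRing.scale/=; ring.
apply: cvgD; last exact: cvgMr.
by apply: cvgM => //; exact: deriv_within_continuous dg.
Qed.

Lemma deriv_within_id : deriv id 1.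
Proof.
rewrite /has_derivative_within.
have tJ : (within J t^') [set s | s != t].
  exact: cvg_within (nbhs_dnbhs_neq t).
suff : (fun=> 1 : R^o) s @[s --> within J t^'] --> (1 : R^o).
  apply: cvg_trans; apply: near_eq_cvg.  apply: filterS tJ => s /= st.
  by rewrite /GRing.scale/= mulVf ?subr_eq0.
exact: cvg_cst.
Qed.

Lemma deriv_within_affine (a b : R) : deriv (fun s => s * a + b) a.
Proof.
under eq_fun do rewrite mulrC.
suff : deriv (fun s => a * s + b) (a * 1 + 0) by rewrite mulr1 addr0.
apply: deriv_withinD; last exact: deriv_within_cst.
by apply: deriv_withinZ; exact: deriv_within_id.
Qed.

End DerivativeWithin.

(** * From relative derivatives to monotonicity *)

Lemma deriv_within_interior {R : realType} (J : set R) (f : R -> R^o) (t l : R) :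
  nbhs t J -> has_derivative_within J f t (l : R^o) -> is_derive t 1 f (l : R^o).
Proof.
move=> Jt df.
suff h : h^-1 *: ((f \o shift t) (h *: 1) - f t) @[h --> 0^'] --> (l : R^o).
  apply: DeriveDef; first by apply/cvg_ex; exists l.
  exact: cvg_lim.
(* As [J] is a neighbourhood of [t], restricting to [J] does not change the punctured filter. *)
have Jt' : within J t^' = t^'.
  apply/seteqP; split => A /=; last exact: cvg_within.
  by rewrite /within/= => tA; apply: filterS2 tA (nbhs_dnbhs Jt) => s; apply.
move: df; rewrite /has_derivative_within Jt' => df.
(* The substitution [s = h + t] turns the quotient at [t] into the quotient in [h] that defines the
   ordinary derivative. *)
have sh : (h + t) @[h --> (0 : R)^'] --> t^'.
  move=> A; rewrite !/(nbhs _) /= /dnbhs /within /= !nearE => tA.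
  move: tA; rewrite -[X in X -> _]/(\forall y \near t, y != t -> A y) (near_shift 0).
  by apply: filterS => h; rewrite /= subr0 -subr_eq0 addrK; apply.
have := cvg_comp _ _ sh df; apply: cvg_trans; apply: near_eq_cvg.
by apply: nearW => h /=; rewrite addrK [h *: 1]mulr1.
Qed.

(** Since [J] is an interval it contains [[s, t]]. Ordinary derivatives exist on the open interval,
    and at the endpoints, where only one-sided derivatives may be available, continuity on the
    closed interval suffices. *)
Lemma deriv_within_nincr {R : realType} (J : set R) (f df : R -> R) :
    is_interval J ->
    (forall t, J t -> has_derivative_within J (f : R -> R^o) t (df t : R^o)) ->
    (forall t, J t -> df t <= 0) ->
  forall s t, J s -> J t -> s <= t -> f t <= f s.
Proof.
move=> iJ fdf df0 s t Js Jt st.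
have sJ x : s <= x <= t -> J x by exact: (iJ s t).
have d x : x \in `]s, t[ -> is_derive x 1 (f : R -> R^o) (df x : R^o).
  rewrite in_itv/= => /andP[sx xt]; apply: deriv_within_interior (fdf _ _).
    have : nbhs x `]s, t[%classic.
      apply: open_nbhs_nbhs; split; first exact: interval_open.
      by rewrite /= in_itv/= sx xt.
    apply: filterS => y /=; rewrite in_itv/= => /andP[/ltW sy /ltW yt].
    by apply: sJ; rewrite sy.
  by apply: sJ; rewrite !ltW.
apply: (@ler0_derive1_nincr R f s t) => //.
- by move=> x /d[].
- move=> x xst; rewrite derive1E; have -> := @derive_val _ _ _ _ _ _ _ (d x xst).
  by apply/df0/sJ; move: xst; rewrite in_itv/= => /andP[/ltW -> /ltW ->].
- apply/subspace_continuousP => x /=; rewrite in_itv/= => xst.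
  have /deriv_within_continuous fx := fdf x (sJ x xst).
  move=> A xA.
  (* The relative limit unfolded: it says nothing about [y = x], where [f x] lies in [A] because [A]
     is a neighbourhood of it. *)
  have : nbhs x [set y | y != x -> J y -> A (f y)] := fx A xA.
  apply: (@filterS _ (nbhs x)) => y /=; have [-> _ _|yx] := eqVneq y x.
    exact: nbhs_singleton xA.
  by move=> h syt; apply: h => //; apply: sJ; rewrite in_itv/= in syt.
Qed.

(** * The real inner product on complex matrices *)

Section RealInnerProduct.
Context {R : realType}.
Implicit Types (z w : R[i]).

Lemma ReD z w : complex.Re (z + w) = complex.Re z + complex.Re w.
Proof. by case: z; case: w. Qed.

Lemma ImD z w : complex.Im (z + w) = complex.Im z + complex.Im w.
Proof. by case: z; case: w. Qed.

Lemma ReN z : complex.Re (- z) = - complex.Re z.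
Proof. by case: z. Qed.

Lemma ImN z : complex.Im (- z) = - complex.Im z.
Proof. by case: z. Qed.

Lemma Re_mul z w : complex.Re (z * w) =
  complex.Re z * complex.Re w - complex.Im z * complex.Im w.
Proof. by case: z; case: w. Qed.

Lemma Im_mul z w : complex.Im (z * w) =
  complex.Re z * complex.Im w + complex.Im z * complex.Re w.
Proof. by case: z; case: w. Qed.

Lemma Re_conjC z : complex.Re (conjC z) = complex.Re z.
Proof. by case: z. Qed.

Lemma Im_conjC z : complex.Im (conjC z) = - complex.Im z.
Proof. by case: z. Qed.

Lemma Re_sum (I : finType) (F : I -> R[i]) :
  complex.Re (\sum_i F i) = \sum_i complex.Re (F i).
Proof. exact: (big_morph _ ReD). Qed.

Lemma Im_sum (I : finType) (F : I -> R[i]) :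
  complex.Im (\sum_i F i) = \sum_i complex.Im (F i).
Proof. exact: (big_morph _ ImD). Qed.

(** This is the Euclidean inner product of the real vector space formed by the real and imaginary
    parts of the entries. *)
Definition mx_inner {m n} (A B : 'M[R[i]]_(m, n)) : R :=
  complex.Re (\tr (A ^t* *m B)).

Lemma mx_innerE {m n} (A B : 'M[R[i]]_(m, n)) : mx_inner A B =
  \sum_i \sum_j (complex.Re (A i j) * complex.Re (B i j)
                 + complex.Im (A i j) * complex.Im (B i j)).
Proof.
rewrite /mx_inner /mxtrace Re_sum exchange_big; apply: eq_bigr => j _ /=.
rewrite mxE Re_sum; apply: eq_bigr => i _.
by rewrite !mxE Re_mul Re_conjC Im_conjC mulNr opprK.
Qed.

Lemma mx_inner_sym {m n} (A B : 'M[R[i]]_(m, n)) : mx_inner A B = mx_inner B A.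
Proof.
by rewrite !mx_innerE; do 2!apply: eq_bigr => ? _; congr (_ + _); rewrite mulrC.
Qed.

Lemma mx_inner0r {m n} (A : 'M[R[i]]_(m, n)) : mx_inner A 0 = 0.
Proof. by rewrite /mx_inner mulmx0 mxtrace0. Qed.

Lemma mx_innerDr {m n} (A B C : 'M[R[i]]_(m, n)) :
  mx_inner A (B + C) = mx_inner A B + mx_inner A C.
Proof. by rewrite /mx_inner mulmxDr raddfD/= ReD. Qed.

Lemma mx_innerNr {m n} (A B : 'M[R[i]]_(m, n)) : mx_inner A (- B) = - mx_inner A B.
Proof. by rewrite /mx_inner mulmxN raddfN/= ReN. Qed.

Lemma mx_innerZr {m n} (A B : 'M[R[i]]_(m, n)) (a : R) :
  mx_inner A (a%:C *: B) = a * mx_inner A B.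
Proof.
by rewrite /mx_inner -scalemxAr mxtraceZ Re_mul/= mul0r subr0.
Qed.

Lemma mx_inner_sumr {m n} (I : finType) (A : 'M[R[i]]_(m, n))
    (B : I -> 'M[R[i]]_(m, n)) :
  mx_inner A (\sum_i B i) = \sum_i mx_inner A (B i).
Proof. by rewrite /mx_inner mulmx_sumr -Re_sum -(raddf_sum (@mxtrace R[i] n)). Qed.

Lemma mx_inner_ge0 {m n} (A : 'M[R[i]]_(m, n)) : 0 <= mx_inner A A.
Proof.
rewrite mx_innerE; apply: sumr_ge0 => i _; apply: sumr_ge0 => j _.
by rewrite -!expr2 addr_ge0// sqr_ge0.
Qed.

(** Left multiplications by [U] and by [U ^t*] are adjoint to each other; this moves [U] off the
    velocity and onto the gradient. *)
Lemma mx_inner_mulr {m n q} (A : 'M[R[i]]_(m, n)) (U : 'M[R[i]]_(m, q)) B :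
  mx_inner A (U *m B) = mx_inner (U ^t* *m A) B.
Proof.
rewrite /mx_inner mulmxA; congr (complex.Re (\tr (_ *m B))).
by rewrite trmx_mul map_mxM trmxCK.
Qed.

Lemma mx_inner_adj {m n} (A B : 'M[R[i]]_(m, n)) :
  mx_inner (A ^t*) (B ^t*) = mx_inner A B.
Proof.
rewrite !mx_innerE exchange_big; do 2!apply: eq_bigr => ? _ /=.
by rewrite !mxE !Re_conjC !Im_conjC mulrNN.
Qed.

(* The Hermitian part of [A] is orthogonal to its skew-Hermitian part. *)
Lemma mx_inner_skewM {n} (A : 'M[R[i]]_n) :
  mx_inner A (skewM A) = mx_inner (skewM A) (skewM A).
Proof.
have -> : skewM A = (2^-1)%:C *: (A - A ^t*) by rewrite /skewM fmorphV rmorph_nat.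
rewrite !mx_innerZr [in RHS]mx_inner_sym !mx_innerZr.
have AA : mx_inner (A ^t*) (A ^t*) = mx_inner A A by exact: mx_inner_adj.
rewrite [in RHS]mx_innerDr mx_innerNr ![mx_inner (A - _) _]mx_inner_sym.
rewrite !mx_innerDr !mx_innerNr AA [mx_inner (A ^t*) A]mx_inner_sym; by field.
Qed.

Lemma frobenius_norm_sqr {n} (A : 'M[R[i]]_n) :
  frobenius_norm A ^+ 2 = mx_inner A A.
Proof.
rewrite sqr_sqrtr; last by do 2!apply: sumr_ge0 => ? _; exact: sqr_ge0.
rewrite mx_innerE; do 2!apply: eq_bigr => ? _.
by case: (A _ _) => x y; rewrite /= sqr_sqrtr ?addr_ge0 ?sqr_ge0 ?expr2.
Qed.

End RealInnerProduct.

(** * Differentiation rules for complex matrix curves *)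

Section MatrixDerivativeWithin.
Context {R : realType}.
Variables (J : set R) (t : R).

Local Notation deriv f l := (@has_derivative_within R R^o J f t (l : R)).

(** Working with real and imaginary parts of entries reduces every matrix rule to the scalar ones
    and accommodates conjugation, which is only real linear. *)
Definition mx_deriv_within {m n} (A : R -> 'M[R[i]]_(m, n))
    (dA : 'M[R[i]]_(m, n)) := forall i j,
  deriv (fun s => complex.Re (A s i j)) (complex.Re (dA i j)) /\
  deriv (fun s => complex.Im (A s i j)) (complex.Im (dA i j)).

Lemma mx_deriv_within_cst {m n} (A : 'M[R[i]]_(m, n)) :
  mx_deriv_within (fun=> A) 0.
Proof. by move=> i j; rewrite mxE; split; exact: deriv_within_cst. Qed.

Lemma mx_deriv_withinD {m n} (A B : R -> 'M[R[i]]_(m, n)) dA dB :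
  mx_deriv_within A dA -> mx_deriv_within B dB ->
  mx_deriv_within (fun s => A s + B s) (dA + dB).
Proof.
move=> hA hB i j; have [rA iA] := hA i j; have [rB iB] := hB i j.
rewrite mxE ReD ImD; split.
- by under eq_fun do rewrite mxE ReD; exact: deriv_withinD.
- by under eq_fun do rewrite mxE ImD; exact: deriv_withinD.
Qed.

Lemma mx_deriv_withinN {m n} (A : R -> 'M[R[i]]_(m, n)) dA :
  mx_deriv_within A dA -> mx_deriv_within (fun s => - A s) (- dA).
Proof.
move=> hA i j; have [rA iA] := hA i j; rewrite mxE ReN ImN; split.
- by under eq_fun do rewrite mxE ReN; exact: deriv_withinN.
- by under eq_fun do rewrite mxE ImN; exact: deriv_withinN.
Qed.

Lemma mx_deriv_within_sum {m n} (I : finType) (A : I -> R -> 'M[R[i]]_(m, n)) dA :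
  (forall k, mx_deriv_within (A k) (dA k)) ->
  mx_deriv_within (fun s => \sum_k A k s) (\sum_k dA k).
Proof.
move=> hA i j; rewrite summxE Re_sum Im_sum; split.
- under eq_fun do rewrite summxE Re_sum.
  by apply: deriv_within_sum => k; case: (hA k i j).
- under eq_fun do rewrite summxE Im_sum.
  by apply: deriv_within_sum => k; case: (hA k i j).
Qed.

Lemma mx_deriv_withinZ {m n} (a : R -> R) (A : R -> 'M[R[i]]_(m, n)) da dA :
  deriv a da -> mx_deriv_within A dA ->
  mx_deriv_within (fun s => (a s)%:C *: A s) (da%:C *: A t + (a t)%:C *: dA).
Proof.
move=> ha hA i j; have [rA iA] := hA i j.
rewrite !mxE ReD ImD !Re_mul !Im_mul/= !mul0r !subr0 !addr0; split.
- under eq_fun do rewrite mxE Re_mul/= mul0r subr0.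
  exact: deriv_withinM.
- under eq_fun do rewrite mxE Im_mul/= mul0r addr0.
  exact: deriv_withinM.
Qed.

Lemma mx_deriv_withinM {m n q} (A : R -> 'M[R[i]]_(m, n))
    (B : R -> 'M[R[i]]_(n, q)) dA dB :
  mx_deriv_within A dA -> mx_deriv_within B dB ->
  mx_deriv_within (fun s => A s *m B s) (dA *m B t + A t *m dB).
Proof.
move=> hA hB i j; rewrite !mxE -big_split/= Re_sum Im_sum; split.
- under eq_fun do rewrite mxE Re_sum.
  apply: deriv_within_sum => k; have [rA iA] := hA i k; have [rB iB] := hB k j.
  under eq_fun do rewrite Re_mul.
  rewrite ReD !Re_mul addrACA -opprD.
  by apply: deriv_withinB; exact: deriv_withinM.
- under eq_fun do rewrite mxE Im_sum.
  apply: deriv_within_sum => k; have [rA iA] := hA i k; have [rB iB] := hB k j.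
  under eq_fun do rewrite Im_mul.
  rewrite ImD !Im_mul addrACA.
  by apply: deriv_withinD; exact: deriv_withinM.
Qed.

Lemma mx_deriv_within_adj {m n} (A : R -> 'M[R[i]]_(m, n)) dA :
  mx_deriv_within A dA -> mx_deriv_within (fun s => (A s) ^t*) (dA ^t*).
Proof.
move=> hA i j; have [rA iA] := hA j i; rewrite !mxE Re_conjC Im_conjC; split.
- by under eq_fun do rewrite !mxE Re_conjC; exact: rA.
- by under eq_fun do rewrite !mxE Im_conjC; exact: deriv_withinN.
Qed.

Lemma deriv_within_mx_inner {m n} (A : R -> 'M[R[i]]_(m, n)) dA :
  mx_deriv_within A dA ->
  deriv (fun s => 2^-1 * mx_inner (A s) (A s)) (mx_inner (A t) dA).
Proof.
move=> hA; under eq_fun do rewrite mx_innerE.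
(* The product rule yields each term of the inner product twice, and the factor [2^-1]
   compensates. *)
have -> : mx_inner (A t) dA = 2^-1 * \sum_i \sum_j
    ((complex.Re (dA i j) * complex.Re (A t i j)
      + complex.Re (A t i j) * complex.Re (dA i j))
     + (complex.Im (dA i j) * complex.Im (A t i j)
        + complex.Im (A t i j) * complex.Im (dA i j))).
  rewrite mx_innerE mulr_sumr; apply: eq_bigr => i _.
  rewrite mulr_sumr; apply: eq_bigr => j _; by field.
apply: deriv_withinZ; apply: deriv_within_sum => i; apply: deriv_within_sum => j.
by have [rA iA] := hA i j; apply: deriv_withinD; exact: deriv_withinM.
Qed.

Lemma mx_deriv_within_complexM {n} (X Y : R -> 'M[R]_n) (dX dY : 'M[R]_n) :
  (forall i j, deriv (fun s => X s i j) (dX i j)) ->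
  (forall i j, deriv (fun s => Y s i j) (dY i j)) ->
  mx_deriv_within (fun s => complexM (X s) (Y s)) (complexM dX dY).
Proof.
move=> hX hY i j; rewrite mxE/=; split.
- by under eq_fun do rewrite mxE/=; exact: hX.
- by under eq_fun do rewrite mxE/=; exact: hY.
Qed.

Lemma has_derivative_within_entry {m n} (X : R -> 'M[R]_(m, n))
    (dX : 'M[R]_(m, n)) i j :
  has_derivative_within J X t dX -> deriv (fun s => X s i j) (dX i j).
Proof.
move=> hX; rewrite /has_derivative_within.
have -> : (fun s => (s - t)^-1 *: (X s i j - X t i j : R^o)) =
    (fun M : 'M[R]_(m, n) => M i j) \o (fun s => (s - t)^-1 *: (X s - X t)).
  by apply/funext => s; rewrite /= !mxE.
exact: cvg_comp hX (@coord_continuous R _ _ i j dX).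
Qed.

End MatrixDerivativeWithin.

(** * The chain rule for the objective and its gradients *)

(** Taking the whole line as the set leaves the punctured filter at 0, so partial derivatives become
    instances of the rules for curves. *)
Lemma derive_line {R : realType} {V : normedModType R} (F : V -> R) (a v : V) (l : R) :
  has_derivative_within setT (fun s => F (s *: v + a) : R^o) 0 (l : R^o) ->
  'D_v F a = l.
Proof.
rewrite /has_derivative_within withinET => h.
apply: cvg_lim => //; move: h; under eq_fun do rewrite subr0 scale0r add0r.
exact.
Qed.

Section ObjectiveDerivative.
Context {R : realType} {n r : nat}.
Variables (rho sigma : 'M[R[i]]_n).
Implicit Types (p : 'rV[R]_r) (U : 'I_r -> 'M[R[i]]_n) (V W : 'M[R[i]]_n).

Definition residual p U : 'M[R[i]]_n :=
  sigma - \sum_(k < r) (p 0 k)%:C *: (U k *m rho *m (U k) ^t*).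

(** The partial derivative of [residual] in the weight whose matrix is [V]. *)
Definition dresidual_dp V : 'M[R[i]]_n := - (V *m rho *m V ^t*).

(** The differential of [residual] in one matrix argument, at [V] with weight [a], applied to the
    direction [W]. *)
Definition dresidual_dU (a : R) V W : 'M[R[i]]_n :=
  - (a%:C *: (W *m rho *m V ^t* + V *m rho *m W ^t*)).

Lemma dresidual_dUD a V W W' :
  dresidual_dU a V (W + W') = dresidual_dU a V W + dresidual_dU a V W'.
Proof.
rewrite /dresidual_dU -opprD -scalerDr; congr (- (_ *: _)).
by rewrite raddfD/= map_mxD !mulmxDl mulmxDr addrACA.
Qed.

(** The scalar is real because the adjoint of [W] would conjugate a complex one. *)
Lemma dresidual_dUZ a V (b : R) W :
  dresidual_dU a V (b%:C *: W) = b%:C *: dresidual_dU a V W.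
Proof.
rewrite /dresidual_dU scalerN scalerA mulrC -scalerA; congr (- (_ *: _)).
have -> : (b%:C *: W) ^t* = b%:C *: W ^t*.
  apply/matrixP => i j; rewrite !mxE rmorphM; congr (_ * _); exact: conjc_real.
by rewrite -!scalemxAl -scalemxAr -scalerDr.
Qed.

Lemma dresidual_dU0 a V : dresidual_dU a V 0 = 0.
Proof.
by rewrite -[X in dresidual_dU a V X](scale0r 0) (dresidual_dUZ _ _ 0) scale0r.
Qed.

Lemma objectiveE p U : objective rho sigma p U =
  2^-1 * mx_inner (residual p U) (residual p U).
Proof. by rewrite /objective frobenius_norm_sqr. Qed.

(** The set and the curve are arbitrary so that the same formula covers the trajectory and the lines
    behind the partial derivatives. *)
Lemma deriv_within_objective (J : set R) (t : R) (p : R -> 'rV[R]_r)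
    (U : R -> 'I_r -> 'M[R[i]]_n) (dp : 'I_r -> R) (dU : 'I_r -> 'M[R[i]]_n) :
    (forall k, @has_derivative_within R R^o J (fun s => p s 0 k) t (dp k)) ->
    (forall k, mx_deriv_within J t (fun s => U s k) (dU k)) ->
  @has_derivative_within R R^o J (fun s => objective rho sigma (p s) (U s)) t
    (\sum_k (dp k * mx_inner (residual (p t) (U t)) (dresidual_dp (U t k))
             + mx_inner (residual (p t) (U t))
                 (dresidual_dU (p t 0 k) (U t k) (dU k)))).
Proof.
move=> hp hU; under eq_fun do rewrite objectiveE.
under eq_bigr do rewrite -mx_innerZr -mx_innerDr.
rewrite -mx_inner_sumr; apply: deriv_within_mx_inner.
(* The right-hand side keeps the zero derivatives of [sigma] and [rho], so that it has the exact
   shape produced by the sum and product rules. *)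
have -> : \sum_k ((dp k)%:C *: dresidual_dp (U t k)
                  + dresidual_dU (p t 0 k) (U t k) (dU k)) =
    0 - \sum_k ((dp k)%:C *: (U t k *m rho *m (U t k) ^t*)
                + (p t 0 k)%:C *: ((dU k *m rho + U t k *m 0) *m (U t k) ^t*
                                   + U t k *m rho *m (dU k) ^t*)).
  rewrite sub0r -sumrN; apply: eq_bigr => k _.
  by rewrite mulmx0 addr0 scalerN opprD.
apply: mx_deriv_withinD; first exact: mx_deriv_within_cst.
apply: mx_deriv_withinN; apply: mx_deriv_within_sum => k.
apply: mx_deriv_withinZ => //.
apply: mx_deriv_withinM; last exact: mx_deriv_within_adj.
by apply: mx_deriv_withinM => //; exact: mx_deriv_within_cst.
Qed.

Lemma dobjective_dpE p U k : dobjective_dp rho sigma p U k =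
  mx_inner (residual p U) (dresidual_dp (U k)).
Proof.
apply: derive_line.
(* On this coordinate line only the weight of index [k] moves, at unit speed, so a single term of
   the sum survives. *)
have := @deriv_within_objective setT 0 (fun s => s *: delta_mx 0 k + p)
  (fun=> U) (fun l => (l == k)%:R) (fun=> 0).
rewrite scale0r add0r (bigD1 k)//= eqxx mul1r dresidual_dU0 mx_inner0r addr0.
rewrite big1 ?addr0; last first.
  by move=> l /negPf lk; rewrite lk mul0r dresidual_dU0 mx_inner0r addr0.
apply=> [l|l]; last exact: mx_deriv_within_cst.
by under eq_fun do rewrite !mxE eqxx/=; exact: deriv_within_affine.
Qed.

Lemma deriv_within_objective_dU p U k (W : R -> 'M[R[i]]_n) (dW : 'M[R[i]]_n) :
    W 0 = U k -> mx_deriv_within setT 0 W dW ->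
  @has_derivative_within R R^o setT
    (fun s => objective rho sigma p [eta U with k |-> W s]) 0
    (mx_inner (residual p U) (dresidual_dU (p 0 k) (U k) dW)).
Proof.
move=> W0 hW.
have := @deriv_within_objective setT 0 (fun=> p)
  (fun s => [eta U with k |-> W s]) (fun=> 0) (fun l => if l == k then dW else 0).
have -> : [eta U with k |-> W 0] = U :> (_ -> _).
  by apply/funext => l /=; case: eqP => [->|].
rewrite (bigD1 k)//= eqxx mul0r add0r.
rewrite big1 ?addr0; last first.
  by move=> l /negPf ->; rewrite mul0r dresidual_dU0 mx_inner0r addr0.
apply=> [l|l]; first exact: deriv_within_cst.
by rewrite /=; case: eqP => // _; exact: mx_deriv_within_cst.
Qed.

Lemma complexM_reM_imM V : complexM (reM V) (imM V) = V.
Proof. by apply/matrixP => i j; rewrite !mxE; case: (V i j). Qed.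

Lemma deriv_within_line_entry (X D : 'M[R]_n) i j :
  @has_derivative_within R R^o setT (fun s => (s *: D + X) i j) 0 (D i j).
Proof.
by under eq_fun do rewrite mxE [(_ *: D) i j]mxE; exact: deriv_within_affine.
Qed.

Lemma dobjective_dU_entry p U k i j : dobjective_dU rho sigma p U k i j =
  mx_inner (residual p U)
    (dresidual_dU (p 0 k) (U k) (complexM (delta_mx i j) 0))
  +i* mx_inner (residual p U)
    (dresidual_dU (p 0 k) (U k) (complexM 0 (delta_mx i j))).
Proof.
rewrite [LHS]mxE; congr (_ +i* _); rewrite [LHS]mxE;
  apply: derive_line; apply: deriv_within_objective_dU.
- by rewrite scale0r add0r complexM_reM_imM.
- apply: mx_deriv_within_complexM => a b; first exact: deriv_within_line_entry.
  by rewrite (_ : (0 : 'M[R]_n) a b = 0) ?[LHS]mxE//; exact: deriv_within_cst.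
- by rewrite scale0r add0r complexM_reM_imM.
- apply: mx_deriv_within_complexM => a b; last exact: deriv_within_line_entry.
  by rewrite (_ : (0 : 'M[R]_n) a b = 0) ?[LHS]mxE//; exact: deriv_within_cst.
Qed.

(** The matrix units and their multiples by the imaginary unit form a real basis; these are the
    directions used in [euclidean_gradient]. *)
Lemma complexM_sum_delta W : W = \sum_i \sum_j
  ((complex.Re (W i j))%:C *: complexM (delta_mx i j) 0
   + (complex.Im (W i j))%:C *: complexM 0 (delta_mx i j)).
Proof.
rewrite [LHS]matrix_sum_delta; do 2!apply: eq_bigr => ? _.
apply/matrixP => a b; rewrite !mxE; case: (W _ _) => x y.
by case: (_ && _); apply/eqP; rewrite eq_complex/=;
  apply/andP; split; apply/eqP; ring.
Qed.

(** The Euclidean gradient represents the differential in [U k]: the two agree on the real basis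
    directions, and both sides are real linear in [W]. *)
Lemma mx_inner_dobjective_dU p U k W :
  mx_inner (dobjective_dU rho sigma p U k) W =
  mx_inner (residual p U) (dresidual_dU (p 0 k) (U k) W).
Proof.
have dS (F : 'I_n -> 'M[R[i]]_n) : dresidual_dU (p 0 k) (U k) (\sum_i F i) =
    \sum_i dresidual_dU (p 0 k) (U k) (F i).
  by apply: big_morph; [exact: dresidual_dUD | exact: dresidual_dU0].
rewrite [in RHS](complexM_sum_delta W) mx_innerE dS mx_inner_sumr.
apply: eq_bigr => i _; rewrite dS mx_inner_sumr; apply: eq_bigr => j _.
rewrite dresidual_dUD !dresidual_dUZ mx_innerDr !mx_innerZr.
by rewrite dobjective_dU_entry/= ![_ * mx_inner _ _]mulrC.
Qed.

End ObjectiveDerivative.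

(** * Sign of the derivative and monotonicity along the flow *)

Lemma sum_mul_center_le0 {R : realFieldType} (r : nat) (g : 'I_r -> R) :
  \sum_k ((- g k + r%:R^-1 * \sum_l g l) * g k) <= 0.
Proof.
case: r g => [|r] g; first by rewrite big_ord0.
set m := _^-1 * _.
have sumg : \sum_l g l = r.+1%:R * m by rewrite mulrA divff ?mul1r.
have -> : \sum_k (- g k + m) * g k = - \sum_k (g k - m) ^+ 2.
  rewrite -sumrN; apply/eqP; rewrite -subr_eq0 -sumrB; apply/eqP.
  (* The termwise difference of the two sums is [m * (m - g k)], whose total vanishes because [m] is
     the mean. *)
  rewrite (eq_bigr (fun k => m * (m - g k))); last by move=> k _; ring.
  by rewrite -mulr_sumr sumrB sumg sumr_const card_ord mulr_natl subrr mulr0.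
by rewrite oppr_le0; apply: sumr_ge0 => k _; exact: sqr_ge0.
Qed.

Theorem theorem3p1 (R : realType) (n r : nat) (n_ge1 : (1 <= n)%N)
    (r_ge1 : (1 <= r)%N) (rho sigma : 'M[R[i]]_n)
    (rho_density : density_mx rho) (sigma_density : density_mx sigma)
    (J : set R) (J_interval : is_interval J) (J_ge0 : J `<=` [set t | 0 <= t])
    (J_0 : J 0)
    (p : R -> 'rV[R]_r) (U : R -> 'I_r -> 'M[R[i]]_n)
    (pU_solution : flow_solution rho sigma J p U)
    (U0_unitary : forall k, U 0 k \is unitarymx)
    (p0_gt0 : forall k, 0 < p 0 0 k)
    (p0_sum1 : \sum_(k < r) p 0 0 k = 1) :
  forall s t, J s -> J t -> s <= t ->
    objective rho sigma (p t) (U t) <= objective rho sigma (p s) (U s).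
Proof.
pose g t k := dobjective_dp rho sigma (p t) (U t) k.
pose G t k := dobjective_dU rho sigma (p t) (U t) k.
pose dU t k := - (U t k *m skewM ((U t k) ^t* *m G t k)).
pose dp t k := - g t k + r%:R^-1 * \sum_l g t l.
apply: (@deriv_within_nincr _ J (fun t => objective rho sigma (p t) (U t))
  (fun t => \sum_k (dp t k * g t k + mx_inner (G t k) (dU t k)))) => // t Jt.
  (* Both gradients are replaced by pairings with the residual, the form in which the chain rule is
     stated. *)
  under eq_bigr do rewrite /g/G dobjective_dpE mx_inner_dobjective_dU.
  apply: deriv_within_objective => k; have [hre him hp] := pU_solution t Jt k.
    exact: hp.
  move=> i j; split.
  - have := has_derivative_within_entry _ _ _ _ i j hre; rewrite [reM _ i j]mxE.
    by under eq_fun do rewrite mxE.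
  - have := has_derivative_within_entry _ _ _ _ i j him; rewrite [imM _ i j]mxE.
    by under eq_fun do rewrite mxE.
rewrite big_split/= -[leRHS]addr0; apply: lerD; first exact: sum_mul_center_le0.
apply: sumr_le0 => k _.
by rewrite mx_innerNr mx_inner_mulr mx_inner_skewM oppr_le0 mx_inner_ge0.
Qed.
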